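(* Let $\ell\ge2$, $R_0^*\in SO(3)$ with unit quaternion representation $w_0^*$, and let $(y_i,x_i)$, $i=1,\dots,\ell$, satisfy $y_i=R_0^*x_i+\epsilon_i$ with $\epsilon_i\in\mathbb{R}^3$ (all pairs are noisy inliers). Let $c_1^2,\dots,c_\ell^2\ge0$, let $\hat w_0\in\mathbb{S}^3$ be a global minimizer of (TLS-Q), and $\hat\omega=[\hat w_0;\dots;\hat w_0]\in\mathbb{R}^{4(\ell+1)}$. Let $$\zeta=\frac{\lambda_{\min 2}\big(\sum_{i=1}^\ell Q_i\big)}{\lambda_{\min}\big(\sum_{i=1}^\ell Q_i\big)}$$ and suppose $\zeta\ge\ell/(\ell-1)$. If for every $i=1,\dots,\ell$ $$c_i^2>\hat w_0^\top Q_i\hat w_0+\|Q_i\hat w_0\|_2+\frac{|d_i|+d_i}{2},\qquad d_i:=\frac{\sum_{k=1}^\ell\hat w_0^\top Q_k\hat w_0}{\ell}-\hat w_0^\top Q_i\hat w_0+\frac{\lambda_{\max}\big(\sum_{j\ne i}(Q_i-Q_j)\big)}{\zeta(\ell-1)},$$ then (SDR) is tight. Moreover, the angle $\hat\tau_0^*$ between $\hat w_0$ and $w_0^*$ satisfies $$\sin^2(\hat\tau_0^* ):=1-(\hat w_0^\top w_0^* )^2\le\frac{4\sum_{i=1}^\ell\|\epsilon_i\|_2\|x_i\|_2}{\lambda_{\min 2}\big(\sum_{i=1}^\ell P_i\big)}.$$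
   Context: For $w=[w_1;w_2;w_3;w_4]\in\mathbb{S}^3$, $R(w)=\begin{bmatrix} w_1^2+w_2^2-w_3^2-w_4^2 & 2(w_2w_3-w_1w_4) & 2(w_2w_4+w_1w_3)\\ 2(w_2w_3+w_1w_4) & w_1^2+w_3^2-w_2^2-w_4^2 & 2(w_3w_4-w_1w_2)\\ 2(w_2w_4-w_1w_3) & 2(w_3w_4+w_1w_2) & w_1^2+w_4^2-w_2^2-w_3^2\end{bmatrix}\in SO(3)$; $\pm w$ are the unit quaternion representations of $R(w)$. $Q_i$ is the unique symmetric $4\times4$ matrix with $w^\top Q_iw=\|y_i-R(w)x_i\|_2^2$ for all $w\in\mathbb{S}^3$, and $P_i$ the unique symmetric $4\times4$ matrix with $w^\top P_iw=\|R_0^*x_i-R(w)x_i\|_2^2$ for all $w\in\mathbb{S}^3$ (the ''pure data'' part of $Q_i$; $P_i\succeq0$, $P_iw_0^*=0$). $\lambda_{\min},\lambda_{\min2},\lambda_{\max}$ denote the smallest, second smallest (counting multiplicity) and largest eigenvalues. (TLS-Q) is $\min_{w_0\in\mathbb{S}^3}\sum_{i=1}^\ell\min\{w_0^\top Q_iw_0,c_i^2\}$. For $\mathcal{A}\in\mathbb{R}^{4(\ell+1)\times4(\ell+1)}$, $[\mathcal{A}]_{ij}$ ($0\le i,j\le\ell$) is the $4\times4$ block in rows $4i+1..4i+4$, columns $4j+1..4j+4$. $\mathcal{Q}$ is symmetric with $[\mathcal{Q}]_{0i}=[\mathcal{Q}]_{i0}=\frac12(Q_i-c_i^2I_4)$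 ($i\ge1$), other blocks zero. (QCQP): minimize $\operatorname{tr}(\mathcal{Q}\omega\omega^\top)+\sum_ic_i^2$ over $\omega\in\mathbb{R}^{4(\ell+1)}$ s.t. $[\omega\omega^\top]_{0i}=[\omega\omega^\top]_{ii}$ ($i=1..\ell$), $\operatorname{tr}([\omega\omega^\top]_{00})=1$. (SDR): minimize $\operatorname{tr}(\mathcal{Q}\mathcal{W})+\sum_ic_i^2$ over symmetric $\mathcal{W}\succeq0$ with the same constraints on $\mathcal{W}$. (SDR) is tight if it admits $\hat\omega\hat\omega^\top$ as a global minimizer, where $\hat\omega$ is a global minimizer of (QCQP) (here $\hat\omega=[\hat w_0;\dots;\hat w_0]$). *)

(* Defs.v *)
From HB Require Import structures.
From mathcomp Require Import all_boot all_order all_algebra.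
From mathcomp Require Import polyrcf.
From mathcomp Require Import zify.
Set Implicit Arguments. Unset Strict Implicit. Unset Printing Implicit Defensive.
Import Order.TTheory GRing.Theory Num.Theory.
Local Open Scope ring_scope.

Section Defs.
Variable R : rcfType.

Definition qf n (M : 'M[R]_n) (w : 'cV[R]_n) : R := (w^T *m M *m w) ord0 ord0.

Definition sqnorm n (v : 'cV[R]_n) : R := \sum_(a < n) v a ord0 ^+ 2.
Definition vnorm n (v : 'cV[R]_n) : R := Num.sqrt (sqnorm v).

Definition unit4 (w : 'cV[R]_4) : Prop := sqnorm w = 1.

(** rotation matrix R(w) of a quaternion w = [w1;w2;w3;w4] *)
Definition Rq (w : 'cV[R]_4) : 'M[R]_3 :=
  let w1 := w 0 0 in let w2 := w 1 0 in let w3 := w 2 0 in let w4 := w 3 0 in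
  \matrix_(i < 3, j < 3)
   (match (i : nat), (j : nat) with
    | 0, 0 => w1^+2 + w2^+2 - w3^+2 - w4^+2
    | 0, 1 => 2 * (w2 * w3 - w1 * w4)
    | 0, _ => 2 * (w2 * w4 + w1 * w3)
    | 1, 0 => 2 * (w2 * w3 + w1 * w4)
    | 1, 1 => w1^+2 + w3^+2 - w2^+2 - w4^+2
    | 1, _ => 2 * (w3 * w4 - w1 * w2)
    | _, 0 => 2 * (w2 * w4 - w1 * w3)
    | _, 1 => 2 * (w3 * w4 + w1 * w2)
    | _, _ => w1^+2 + w4^+2 - w2^+2 - w3^+2
    end).

(** Eigenvalues counted with (algebraic) multiplicity, in nondecreasing order:
    the real roots of the characteristic polynomial (rootsR is sorted increasingly),
    each repeated according to its multiplicity.  For a real symmetric matrix the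
    characteristic polynomial splits over R, so this is the full spectrum. *)
Definition spectrum n (A : 'M[R]_n) : seq R :=
  flatten [seq nseq (mup x (char_poly A)) x | x <- rootsR (char_poly A)].
Definition lmin n (A : 'M[R]_n) : R := nth 0 (spectrum A) 0.
Definition lmin2 n (A : 'M[R]_n) : R := nth 0 (spectrum A) 1.
Definition lmax n (A : 'M[R]_n) : R := last 0 (spectrum A).

Definition psd n (A : 'M[R]_n) : Prop := forall v : 'cV[R]_n, 0 <= qf A v.

(** (TLS-Q) objective; families are indexed by nat, paper's index i = 1..l
    corresponds to our index i-1 = 0..l-1. *)
Definition tls (l : nat) (Q : nat -> 'M[R]_4) (c2 : nat -> R) (w : 'cV[R]_4) : R :=
  \sum_(i < l) Num.min (qf (Q i) w) (c2 i).

Lemma blk_idx_proof (l : nat) (i : 'I_l.+1) (a : 'I_4) : (4 * i + a < 4 * l.+1)%N.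
Proof. have := ltn_ord i; have := ltn_ord a; lia. Qed.
Definition blk_idx (l : nat) (i : 'I_l.+1) (a : 'I_4) : 'I_(4 * l.+1) :=
  Ordinal (blk_idx_proof i a).
Definition block (l : nat) (A : 'M[R]_(4 * l.+1)) (i j : 'I_l.+1) : 'M[R]_4 :=
  \matrix_(a < 4, b < 4) A (blk_idx i a) (blk_idx j b).

Definition bigQ (l : nat) (Q : nat -> 'M[R]_4) (c2 : nat -> R) : 'M[R]_(4 * l.+1) :=
  \matrix_(r, s)
    (let i := (r %/ 4)%N in let j := (s %/ 4)%N in
     let a : 'I_4 := inord (r %% 4) in let b : 'I_4 := inord (s %% 4) in
     if (i == 0%N) && (0 < j)%N then ((1/2) *: (Q j.-1 - (c2 j.-1)%:M)) a b
     else if (j == 0%N) && (0 < i)%N then ((1/2) *: (Q i.-1 - (c2 i.-1)%:M)) a b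
     else 0).

Definition sdr_feasible (l : nat) (W : 'M[R]_(4 * l.+1)) : Prop :=
  W^T = W /\ psd W /\
  (forall i : 'I_l.+1, i != ord0 -> block W ord0 i = block W i i) /\
  \tr (block W ord0 ord0) = 1.
Definition sdr_obj (l : nat) (Q : nat -> 'M[R]_4) (c2 : nat -> R)
  (W : 'M[R]_(4 * l.+1)) : R :=
  \tr (bigQ l Q c2 *m W) + \sum_(i < l) c2 i.

Definition omega (l : nat) (w : 'cV[R]_4) : 'cV[R]_(4 * l.+1) :=
  \col_r w (inord (r %% 4)) ord0.

Definition sdr_tight (l : nat) (Q : nat -> 'M[R]_4) (c2 : nat -> R) (w : 'cV[R]_4) : Prop :=
  let W0 := omega l w *m (omega l w)^T in
  sdr_feasible W0 /\
  forall W : 'M[R]_(4 * l.+1), sdr_feasible W -> sdr_obj Q c2 W0 <= sdr_obj Q c2 W.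

(** the quantity d_i (0-based i), with 1/zeta written as lmin(SQ)/lmin2(SQ) *)
Definition dval (l : nat) (Q : nat -> 'M[R]_4) (w : 'cV[R]_4) (i : nat) : R :=
  let SQ := \sum_(k < l) Q k in
  (\sum_(k < l) qf (Q k) w) / l%:R - qf (Q i) w
  + lmax (\sum_(j < l | (j : nat) != i) (Q i - Q j)) * (lmin SQ / lmin2 SQ) / (l.-1)%:R.

End Defs.

(* Main.v *)
(** With [S = \sum_i Q i], truncation is inactive at [wh], so [wh] minimizes the
    Rayleigh quotient of [S]: it is an eigenvector for [lam = lmin S], and
    [S >= lmin2 S] on its orthogonal complement.  Since [0 <= W_ii <= W_00] for
    every feasible [W], matrices [T i] with [T i <= Q i], [T i <= c2 i] and
    [\sum_i T i = lam] certify that the relaxation has value at least [lam],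
    which [wh] attains.  Take [T i = Q i] except on the complement of [wh],
    where [T i = lam / l + k (l Q i - S)] with [k = (lam / lmin2 S) / (l - 1)]:
    the gap hypothesis gives [T i <= Q i], the bound on [c2 i] gives
    [T i <= c2 i].

    For the angle, [\sum_i P i] kills [w0s] and is at least its second eigenvalue
    on the complement of [w0s], while optimality of [wh] against [w0s] bounds its
    value at [wh] by the noise. *)
Require Import Defs.
From HB Require Import structures.
From mathcomp Require Import all_boot all_order all_algebra.
From mathcomp Require Import polyrcf.
From mathcomp Require Import complex zify ring lra.
Set Implicit Arguments. Unset Strict Implicit. Unset Printing Implicit Defensive.
Import Order.TTheory GRing.Theory Num.Theory.
Local Open Scope ring_scope.

(** * Spectral theorem for symmetric matrices over a real closed field *)

Section Spectral.
Variable R : rcfType.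

(** Over the closure [R[i]] an eigenvalue [a] with eigenvector [v] exists. The matrix is Hermitian
    there, so [v C v^*] equals both [a z] and [a^* z] with [z = v v^*] nonzero. Hence [a] is real
    and is a root of the characteristic polynomial over [R]. *)
Lemma symmetric_eigenvalue n (A : 'M[R]_n) :
  (0 < n)%N -> A^T = A -> exists a, eigenvalue A a.
Proof.
move=> n_gt0 symA; pose toC := real_complex R; pose C := map_mx toC A.
have [a /eigenvalueP[v vC v0]] := eigenvalue_closed C n_gt0.
have hC : map_mx Num.conj C^T = C.
  apply/matrixP=> i j; rewrite !mxE -{2}symA mxE.
  by apply/CrealP; rewrite complex_real.
pose z := (v *m map_mx Num.conj v^T) 0 0.
have z0 : z != 0.
  by have := dotmx_is_dotmx v0; rewrite dotmxE => /lt0r_neq0.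
have Cv : C *m map_mx Num.conj v^T = a^* *: map_mx Num.conj v^T.
  by rewrite -{1}hC -map_mxM -trmx_mul vC linearZ /= map_mxZ.
have az : a * z = a^* * z.
  have := congr1 (fun M => (M *m map_mx Num.conj v^T) 0 0) vC.
  rewrite -mulmxA Cv -scalemxAr -scalemxAl.
  by rewrite [LHS in LHS = _ -> _]mxE [X in _ = X -> _]mxE => <-.
have /CrealP ra : a^* = a by apply: (mulIf z0).
have ea : a = toC (complex.Re a) by rewrite /toC RRe_real.
exists (complex.Re a); rewrite eigenvalue_root_char.
have : root (char_poly C) a by rewrite -eigenvalue_root_char; apply/eigenvalueP; exists v.
by rewrite -map_char_poly ea fmorph_root.
Qed.

Lemma sqnormE n (v : 'cV[R]_n) : sqnorm v = (v^T *m v) 0 0.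
Proof. by rewrite mxE; apply: eq_bigr => i _; rewrite mxE expr2. Qed.

Lemma sqnorm_ge0 n (v : 'cV[R]_n) : 0 <= sqnorm v.
Proof. by apply: sumr_ge0 => i _; rewrite sqr_ge0. Qed.

Lemma sqnorm_eq0 n (v : 'cV[R]_n) : (sqnorm v == 0) = (v == 0).
Proof.
apply/idP/eqP => [|->]; last by rewrite sqnormE mulmx0 mxE.
rewrite psumr_eq0 => [/allP v0|i _]; last exact: sqr_ge0.
apply/colP=> i; rewrite mxE; apply/eqP.
by have := v0 i (mem_index_enum i); rewrite sqrf_eq0.
Qed.

Lemma sqnormZ n (a : R) (v : 'cV[R]_n) : sqnorm (a *: v) = a ^+ 2 * sqnorm v.
Proof. by rewrite /sqnorm mulr_sumr; apply: eq_bigr => i _; rewrite mxE exprMn. Qed.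

Lemma normalize n (v : 'cV[R]_n) : v != 0 ->
  exists2 r, r != 0 & sqnorm (r *: v) = 1.
Proof.
move=> v0; have v1 : sqnorm v != 0 by rewrite sqnorm_eq0.
exists (Num.sqrt (sqnorm v))^-1.
  by rewrite invr_eq0 sqrtr_eq0 -ltNge lt_neqAle eq_sym v1 sqnorm_ge0.
by rewrite sqnormZ exprVn sqr_sqrtr ?sqnorm_ge0 ?mulVf.
Qed.

(* A Householder reflection sends the first basis vector to [v]. *)
Lemma orthogonal_first_row n (v : 'rV[R]_n.+1) : v *m v^T = 1%:M ->
  exists2 H : 'M[R]_n.+1, H *m H^T = 1%:M & row 0 H = v.
Proof.
move=> v1; pose e : 'rV[R]_n.+1 := delta_mx 0 0.
have [<-|ve] := eqVneq e v; first by exists 1%:M; rewrite ?trmx1 ?mulmx1 ?row1.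
pose w := v - e; pose s := (w *m w^T) 0 0.
have s0 : s != 0.
  have -> : s = sqnorm w^T by rewrite sqnormE trmxK.
  by rewrite sqnorm_eq0 trmx_eq0 subr_eq0 eq_sym.
have ww : w *m w^T = s%:M by rewrite [LHS]mx11_scalar.
have ee : e *m e^T = 1%:M.
  by apply/matrixP=> i j; rewrite !ord1 trmx_delta mul_delta_mx !mxE.
pose t := (e *m v^T) 0 0.
have ev : e *m v^T = t%:M by rewrite [LHS]mx11_scalar.
have vet : v *m e^T = t%:M by rewrite -[LHS]trmxK trmx_mul trmxK ev tr_scalar_mx.
have st : s = 2 - 2 * t.
  rewrite /s /w linearB /= mulmxBl !mulmxBr v1 ee ev vet !mxE /=.
  by rewrite !mulr1n; ring.
pose H := 1%:M - (2 / s) *: (w^T *m w).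
have HT : H^T = H.
  by rewrite /H linearB linearZ /= trmx1 trmx_mul trmxK.
exists H.
  pose X := w^T *m w.
  have XX : X *m X = s *: X.
    by rewrite /X mulmxA -(mulmxA w^T) ww mul_mx_scalar -scalemxAl.
  rewrite HT /H -/X mulmxBl mul1mx mulmxBr mulmx1 -scalemxAl -scalemxAr XX.
  rewrite !scalerA -addrA -opprD addrA -scalerDl -scalerBl.
  by rewrite [X in X *: _](_ : _ = 0) ?scale0r ?subr0 //; field.
rewrite rowE -/e /H mulmxBr mulmx1 -scalemxAr mulmxA.
have -> : e *m w^T = (t - 1)%:M.
  by rewrite /w linearB /= mulmxBr ev ee -raddfB.
rewrite mul_scalar_mx scalerA (_ : 2 / s * (t - 1) = -1).
  by rewrite scaleN1r opprK /w addrC subrK.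
have -> : t = 1 - s / 2 by rewrite st; field.
by field.
Qed.

(** Deflation: a unit eigenvector is completed to an orthogonal [H] having it as first row. The
    first row of [H A H^T] is then [a] times the first basis vector, symmetry clears the first
    column as well, and induction applies to the remaining block. *)
Theorem real_spectral n (A : 'M[R]_n) : A^T = A ->
  exists (U : 'M[R]_n) (d : 'rV[R]_n),
    U *m U^T = 1%:M /\ A = U^T *m diag_mx d *m U.
Proof.
elim: n A => [|n IHn] A symA.
  by exists 0, 0; split; apply/matrixP => -[].
have [a /eigenvalueP[v0 v0A v0N0]] := symmetric_eigenvalue (ltn0Sn n) symA.
have [r rN0 r1] : exists2 r, r != 0 & sqnorm (r *: v0^T) = 1.
  by apply: normalize; rewrite trmx_eq0.
pose v := r *: v0.
have v1 : v *m v^T = 1%:M.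
  by rewrite [LHS]mx11_scalar -{1}(trmxK v) -sqnormE /v linearZ /= r1.
have vA : v *m A = a *: v by rewrite /v -scalemxAl v0A !scalerA mulrC.
have [H HH Hv] := orthogonal_first_row v1.
have HtH : H^T *m H = 1%:M by apply: mulmx1C.
pose B : 'M[R]_(1 + n) := H *m A *m H^T.
have symB : B^T = B by rewrite /B !trmx_mul trmxK symA mulmxA.
have rowB : row 0 B = a *: delta_mx 0 0.
  by rewrite /B !row_mul Hv vA -scalemxAl -Hv -row_mul HH row1.
have ulB : ulsubmx B = a%:M.
  apply/matrixP=> i j; rewrite !ord1 !mxE.
  have := congr1 (fun M : 'rV__ => M 0 0) rowB; rewrite !mxE /= mulr1.
  by rewrite !lshift0 => ->.
have urB : ursubmx B = 0.
  apply/matrixP=> i j; rewrite !ord1 !mxE lshift0.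
  have := congr1 (fun M : 'rV__ => M 0 (rshift 1 j)) rowB.
  by rewrite !mxE /= mulr0.
have dlB : dlsubmx B = 0 by rewrite -symB -trmx_ursub urB trmx0.
have symD : (drsubmx B)^T = drsubmx B by rewrite trmx_drsub symB.
have [U' [d' [UU' dB]]] := IHn _ symD.
pose V : 'M[R]_(1 + n) := block_mx 1%:M 0 0 U'.
have VT : V^T = block_mx 1%:M 0 0 U'^T by rewrite /V tr_block_mx !trmx0 trmx1.
have VV : V *m V^T = 1%:M.
  rewrite VT /V mulmx_block.
  by rewrite !mul0mx !mulmx0 !addr0 add0r mul1mx UU' -scalar_mx_block.
exists (V *m H), (row_mx a%:M d'); split.
  by rewrite trmx_mul mulmxA -(mulmxA V) HH mulmx1; exact: VV.
have eB : B = V^T *m diag_mx (row_mx a%:M d') *m V.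
  rewrite -[LHS]submxK ulB urB dlB dB diag_mx_row VT /V !mulmx_block.
  rewrite !(mul0mx, mulmx0, addr0, add0r, mul1mx, mulmx1).
  by congr block_mx; apply/matrixP=> i j; rewrite !ord1 !mxE.
rewrite trmx_mul -!mulmxA (mulmxA (diag_mx _)) (mulmxA V^T) (mulmxA V^T) -eB /B.
by rewrite !mulmxA HtH mul1mx -mulmxA HtH mulmx1.
Qed.
End Spectral.

(** * The sorted spectrum and Rayleigh quotients *)

Section Spectrum.
Variable R : rcfType.

Lemma char_poly_conj n (U A : 'M[R]_n) : U *m U^T = 1%:M ->
  char_poly (U^T *m A *m U) = char_poly A.
Proof.
move=> UU; pose c := map_mx (@polyC R).
have cUtU : c _ _ U^T *m c _ _ U = 1%:M by rewrite -map_mxM mulmx1C // map_mx1.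
have -> : char_poly (U^T *m A *m U) = \det (c _ _ U^T *m char_poly_mx A *m c _ _ U).
  congr (\det _); rewrite /char_poly_mx mulmxBr mulmxBl -!map_mxM mul_mx_scalar.
  by rewrite -scalemxAl cUtU scalemx1.
rewrite !det_mulmx mulrC mulrA -det_mulmx.
by rewrite (mulmx1C cUtU) det1 mul1r.
Qed.

Lemma sorted_flatten_nseq (s : seq R) (m : R -> nat) :
  sorted <%R s -> sorted <=%R (flatten [seq nseq (m x) x | x <- s]).
Proof.
elim: s => //= x s IHs xs.
rewrite sorted_pairwise; last exact: le_trans.
rewrite pairwise_cat -sorted_pairwise; last exact: le_trans.
rewrite -sorted_pairwise; last exact: le_trans.
rewrite IHs ?(path_sorted xs) // andbT; apply/andP; split; last first.
  by elim: (m x) => //= k; case: k => //= k ->; rewrite lexx.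
apply/allrelP=> a b /nseqP[-> _] /flatten_mapP[y ys /nseqP[-> _]].
have := order_path_min lt_trans xs => /allP /(_ y ys); exact: ltW.
Qed.

Lemma sorted_spectrum n (A : 'M[R]_n) : sorted <=%R (spectrum A).
Proof. by apply: sorted_flatten_nseq; rewrite /rootsR; exact: sorted_roots. Qed.

(** This ties [spectrum], defined by roots, to any orthogonal diagonalization. Both lists contain
    each [x] as often as its multiplicity as a root of the product of the [X - d i]. *)
Lemma perm_spectrum n (U : 'M[R]_n) (d : 'rV[R]_n) : U *m U^T = 1%:M ->
  perm_eq (spectrum (U^T *m diag_mx d *m U)) [seq d 0 i | i <- enum 'I_n].
Proof.
move=> UU; set s := map _ _; rewrite /spectrum char_poly_conj //.
have ->: char_poly (diag_mx d) = \prod_(y <- s) ('X - y%:P).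
  rewrite char_poly_trig ?diag_mx_is_trig // big_map big_enum /=.
  by apply: eq_bigr => i _; rewrite mxE eqxx.
set p := \prod_(y <- s) _; have p0 : p != 0 by rewrite monic_neq0 ?monic_prod_XsubC.
apply/allP=> x _; apply/eqP; rewrite /= -[RHS]mu_prod_XsubC -/p.
have un : uniq (rootsR p).
  by apply: (sorted_uniq lt_trans ltxx); rewrite /rootsR; exact: sorted_roots.
rewrite count_flatten -map_comp.
have [xr|xNr] := boolP (x \in rootsR p); last first.
  have -> : mup x p = 0%N.
    by rewrite mupNroot //; have /(_ x) := roots_on_rootsR p0; rewrite (negPf xNr) /= => ->.
  rewrite sumnE big_map big_seq big1 // => y yr /=; rewrite count_nseq /=.
  by case: eqP xNr => // <-; rewrite yr.
rewrite sumnE big_map (bigD1_seq x) //= count_nseq /= eqxx mul1n big1 ?addn0 //.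
by move=> y /negPf yx; rewrite count_nseq /= yx.
Qed.


Lemma nth0_le_sorted (s : seq R) x : sorted <=%R s -> x \in s -> nth 0 s 0 <= x.
Proof.
case: s => // a s /= /(order_path_min le_trans)/allP ams.
by rewrite inE => /predU1P[->|/ams].
Qed.

Lemma le_last_sorted (s : seq R) x : sorted <=%R s -> x \in s -> x <= last 0 s.
Proof.
case/lastP: s => // s a; rewrite last_rcons sorted_pairwise; last exact: le_trans.
rewrite pairwise_rcons => /andP[/allP sa _].
by rewrite mem_rcons inE => /predU1P[->|/sa].
Qed.

(** This is how multiplicity enters [lmin2]: two distinct eigenvector indices cannot both have
    eigenvalues strictly below it. *)
Lemma count_lt_nth1_sorted (s : seq R) :
  sorted <=%R s -> (count (fun x => (x < nth 0 s 1)%R) s <= 1)%N.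
Proof.
case: s => [|a [|b s]] //=; first by move=> _; case: (_ < _).
case/andP=> _ /(order_path_min le_trans)/allP bs.
rewrite ltxx (@eq_in_count _ _ pred0) ?count_pred0; first by case: (_ < _).
by move=> x /bs; rewrite leNgt => /negPf.
Qed.

Lemma mulmx_col m n p (A : 'M[R]_(m, n)) (B : 'M[R]_(n, p)) i :
  A *m col i B = col i (A *m B).
Proof. by rewrite !colE mulmxA. Qed.

Lemma qf_spectral n (U : 'M[R]_n) (d : 'rV[R]_n) v :
  qf (U^T *m diag_mx d *m U) v = \sum_i d 0 i * (U *m v) i 0 ^+ 2.
Proof.
rewrite /qf -!mulmxA (mulmxA v^T) -trmx_mul mulmxA mxE.
by apply: eq_bigr => i _; rewrite mul_mx_diag !mxE; ring.
Qed.

Lemma dot_orthogonal n (U : 'M[R]_n) (u v : 'cV[R]_n) : U *m U^T = 1%:M ->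
  (u^T *m v) 0 0 = \sum_i (U *m u) i 0 * (U *m v) i 0.
Proof.
move=> UU; rewrite -[v in LHS]mul1mx -(mulmx1C UU) -mulmxA mulmxA -trmx_mul mxE.
by apply: eq_bigr => i _; rewrite !mxE.
Qed.

Lemma sqnorm_orthogonal n (U : 'M[R]_n) (v : 'cV[R]_n) : U *m U^T = 1%:M ->
  sqnorm v = \sum_i (U *m v) i 0 ^+ 2.
Proof.
by move=> UU; rewrite sqnormE (dot_orthogonal _ _ UU); apply: eq_bigr => i _; rewrite expr2.
Qed.

Lemma qf_spectral_row n (U : 'M[R]_n) (d : 'rV[R]_n) i : U *m U^T = 1%:M ->
  qf (U^T *m diag_mx d *m U) (row i U)^T = d 0 i.
Proof.
move=> UU; rewrite qf_spectral tr_row mulmx_col UU (bigD1 i) //= big1.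
  by rewrite !mxE eqxx expr1n mulr1 addr0.
by move=> j /negPf ji; rewrite !mxE ji expr0n mulr0.
Qed.

Lemma sqnorm_row_orthogonal n (U : 'M[R]_n) i : U *m U^T = 1%:M ->
  sqnorm (row i U)^T = 1.
Proof.
by move=> UU; rewrite sqnormE trmxK tr_row -row_mul mulmx_col UU !mxE eqxx.
Qed.

Lemma qf_le_lmax n (A : 'M[R]_n) v : A^T = A -> qf A v <= lmax A * sqnorm v.
Proof.
move=> symA; have [U [d [UU eA]]] := real_spectral symA.
rewrite [X in qf X]eA qf_spectral (sqnorm_orthogonal _ UU) mulr_sumr.
apply: ler_sum => i _; rewrite ler_wpM2r ?sqr_ge0 //.
apply: le_last_sorted; first exact: sorted_spectrum.
by rewrite eA (perm_mem (perm_spectrum _ UU)) map_f ?mem_enum.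
Qed.

(** In an orthonormal eigenbasis [u_i] of [A] the trace is the sum of the [d_i * qf B u_i], and
    [d_i = qf A u_i] is nonnegative. *)
Lemma mxtrace_mul_psd n (A B : 'M[R]_n) : A^T = A -> psd A -> psd B ->
  0 <= \tr (A *m B).
Proof.
move=> symA pA pB; have [U [d [UU eA]]] := real_spectral symA.
rewrite eA -!mulmxA mxtrace_mulC -!mulmxA.
apply: sumr_ge0 => i _; rewrite mul_diag_mx mxE mulr_ge0 //.
  by rewrite -(qf_spectral_row d i UU) -eA.
have -> : (U *m (B *m U^T)) i i = qf B (row i U)^T.
  by rewrite /qf trmxK mulmxA tr_row -row_mul mulmx_col -row_mul [RHS]mxE [RHS]mxE.
exact: pB.
Qed.

Section RayleighMin.
Variables (n : nat) (A : 'M[R]_n) (w : 'cV[R]_n) (a : R).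
Hypotheses (symA : A^T = A) (w1 : sqnorm w = 1) (wA : qf A w = a).
Hypothesis Amin : forall v, a * sqnorm v <= qf A v.

(** In eigencoordinates [y = U w], attaining the minimum means that the nonnegative terms
    [(d_i - a) y_i ^ 2] sum to zero. So [w] is supported on the indices with [d_i = a], which makes
    it an eigenvector. *)
Lemma rayleigh_min :
  [/\ A *m w = a *: w, lmin A = a &
      forall v, (w^T *m v) 0 0 = 0 -> lmin2 A * sqnorm v <= qf A v].
Proof.
have [U [d [UU eA]]] := real_spectral symA; have UtU := mulmx1C UU.
pose y := U *m w.
have da i : a <= d 0 i.
  have := Amin (row i U)^T; rewrite sqnorm_row_orthogonal // mulr1.
  by rewrite [in qf _ _]eA qf_spectral_row.
have : \sum_i (d 0 i - a) * y i 0 ^+ 2 = 0.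
  transitivity (qf A w - a * sqnorm w); last by rewrite wA w1 mulr1 subrr.
  rewrite [in qf _ _]eA qf_spectral (sqnorm_orthogonal _ UU) mulr_sumr -sumrB.
  by apply: eq_bigr => i _; rewrite mulrBl.
move/eqP; rewrite psumr_eq0 => [/allP dy|i _]; last first.
  by rewrite mulr_ge0 ?sqr_ge0 // subr_ge0.
have {}dy i : y i 0 != 0 -> d 0 i = a.
  move=> yi; have := dy i (mem_index_enum i); rewrite mulf_eq0 sqrf_eq0 (negPf yi) orbF.
  by rewrite subr_eq0 => /eqP.
have [i0 yi0] : exists i, y i 0 != 0.
  apply/existsP; rewrite -[X in is_true X]negbK negb_exists; apply/negP => /forallP y0.
  have := sqnorm_orthogonal w UU; rewrite w1 big1 => [/eqP|i _].
    by rewrite oner_eq0.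
  by have := y0 i; rewrite negbK => /eqP; rewrite -/y => ->; rewrite expr0n.
have sA := sorted_spectrum A; have pA := perm_spectrum d UU; rewrite -eA in pA.
have memA i : d 0 i \in spectrum A by rewrite (perm_mem pA) map_f ?mem_enum.
have lminA : lmin A = a.
  apply/eqP; rewrite eq_le -{1}(dy _ yi0) nth0_le_sorted //=.
  have : lmin A \in spectrum A.
    by apply: mem_nth; case: (spectrum A) (memA i0).
  by rewrite (perm_mem pA) => /mapP[i _ ->].
(* If [a < lmin2 A], both [i] and [i0] would index eigenvalues strictly below [lmin2 A]. *)
have lmin2A i : i != i0 -> d 0 i < lmin2 A -> lmin2 A <= a.
  move=> ii0 di; rewrite leNgt; apply/negP => al.
  have := count_lt_nth1_sorted sA; rewrite -/(lmin2 A) (permP pA) count_map.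
  rewrite -size_filter leqNgt => /negP; apply.
  apply: (@uniq_leq_size _ [:: i; i0]); first by rewrite /= inE ii0.
  move=> j; rewrite !inE mem_filter mem_enum andbT /= => /orP[]/eqP -> //.
  by rewrite dy.
split => //.
  rewrite eA -!mulmxA -/y -[w in RHS]mul1mx -UtU -mulmxA -/y scalemxAr.
  congr (_ *m _); apply/colP=> i; rewrite mul_diag_mx [LHS]mxE [RHS]mxE.
  by have [->|/dy ->//] := eqVneq (y i 0) 0; rewrite !mulr0.
move=> v; rewrite [in qf _ _]eA qf_spectral (dot_orthogonal _ _ UU) -/y => wv.
rewrite (sqnorm_orthogonal _ UU) mulr_sumr.
apply: ler_sum => i _; rewrite leNgt; apply/negP.
have [|di] := leP (lmin2 A) (d 0 i).
  by move=> le; rewrite ltNge ler_wpM2r ?sqr_ge0.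
(* Only [i0] can have its eigenvalue below [lmin2 A]. In that case [y] vanishes at every other
   index, so orthogonality to [w] forces the [i0] coordinate of [v] to be zero. *)
have [ii0|ii0] := eqVneq i i0; last first.
  by have := da i; rewrite leNgt (lt_le_trans di (lmin2A _ ii0 di)).
suff -> : (U *m v) i 0 = 0 by rewrite expr0n !mulr0 ltxx.
move: wv; rewrite (bigD1 i0) //= big1 ?addr0 => [/eqP|j ji0].
  by rewrite mulf_eq0 (negPf yi0) ii0 => /eqP.
have [->|/dy dj] := eqVneq (y j 0) 0; first by rewrite mul0r.
have : lmin2 A <= a.
  by apply: (lmin2A j) => //; rewrite dj -(dy _ yi0) -ii0.
by rewrite -(dy _ yi0) -ii0 leNgt di.
Qed.

End RayleighMin.
End Spectrum.

(** * Quadratic forms, norms and projection off a vector *)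

Section Forms.
Variable R : rcfType.

Definition dotv n (u v : 'cV[R]_n) : R := (u^T *m v) 0 0.

Lemma dotvE n (u v : 'cV[R]_n) : dotv u v = \sum_i u i 0 * v i 0.
Proof. by rewrite /dotv mxE; apply: eq_bigr => i _; rewrite mxE. Qed.
Lemma dotvC n (u v : 'cV[R]_n) : dotv u v = dotv v u.
Proof. by rewrite !dotvE; apply: eq_bigr => i _; rewrite mulrC. Qed.
Lemma dotvDl n (u v w : 'cV[R]_n) : dotv (u + v) w = dotv u w + dotv v w.
Proof. by rewrite /dotv linearD mulmxDl mxE. Qed.
Lemma dotvDr n (u v w : 'cV[R]_n) : dotv w (u + v) = dotv w u + dotv w v.
Proof. by rewrite /dotv mulmxDr mxE. Qed.
Lemma dotvZl n a (u v : 'cV[R]_n) : dotv (a *: u) v = a * dotv u v.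
Proof. by rewrite /dotv linearZ -scalemxAl mxE. Qed.
Lemma dotvZr n a (u v : 'cV[R]_n) : dotv u (a *: v) = a * dotv u v.
Proof. by rewrite /dotv -scalemxAr mxE. Qed.
Lemma dotvv n (u : 'cV[R]_n) : dotv u u = sqnorm u.
Proof. by rewrite sqnormE. Qed.
Lemma dotv_mull n (A : 'M[R]_n) u v : dotv (A *m u) v = dotv u (A^T *m v).
Proof. by rewrite /dotv trmx_mul mulmxA. Qed.

Lemma qf_dotv n (A : 'M[R]_n) v : qf A v = dotv v (A *m v).
Proof. by rewrite /qf /dotv mulmxA. Qed.
Lemma qfD n (A B : 'M[R]_n) v : qf (A + B) v = qf A v + qf B v.
Proof. by rewrite !qf_dotv mulmxDl dotvDr. Qed.
Lemma qfZ n a (A : 'M[R]_n) v : qf (a *: A) v = a * qf A v.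
Proof. by rewrite !qf_dotv -scalemxAl dotvZr. Qed.
Lemma qfB n (A B : 'M[R]_n) v : qf (A - B) v = qf A v - qf B v.
Proof. by rewrite qfD -scaleN1r qfZ mulN1r. Qed.
Lemma qf_scalar n a (v : 'cV[R]_n) : qf a%:M v = a * sqnorm v.
Proof. by rewrite qf_dotv mul_scalar_mx dotvZr dotvv. Qed.
Lemma qf_sum n (I : Type) (r : seq I) (P : pred I) (F : I -> 'M[R]_n) v :
  qf (\sum_(i <- r | P i) F i) v = \sum_(i <- r | P i) qf (F i) v.
Proof.
apply: (big_morph (fun A => qf A v)) => [A B|]; first exact: qfD.
by rewrite qf_dotv mul0mx /dotv mulmx0 mxE.
Qed.
Lemma qf_conj n (A P : 'M[R]_n) v : P^T = P -> qf (P *m A *m P) v = qf A (P *m v).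
Proof. by move=> symP; rewrite !qf_dotv dotv_mull symP !mulmxA. Qed.
Lemma qfZv n (A : 'M[R]_n) a v : qf A (a *: v) = a ^+ 2 * qf A v.
Proof. by rewrite !qf_dotv -scalemxAr dotvZl dotvZr mulrA expr2. Qed.
Lemma qfDv n (A : 'M[R]_n) u v : A^T = A ->
  qf A (u + v) = qf A u + 2 * dotv (A *m u) v + qf A v.
Proof.
move=> symA; rewrite !qf_dotv mulmxDr !dotvDl !dotvDr.
by rewrite (dotvC u (A *m v)) !dotv_mull symA (dotvC v (A *m u)) dotv_mull symA; ring.
Qed.
Lemma sqnormD n (u v : 'cV[R]_n) :
  sqnorm (u + v) = sqnorm u + 2 * dotv u v + sqnorm v.
Proof. by rewrite -!dotvv !dotvDl !dotvDr (dotvC v u); ring. Qed.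
Lemma sqnormN n (v : 'cV[R]_n) : sqnorm (- v) = sqnorm v.
Proof. by rewrite -scaleN1r sqnormZ sqrrN expr1n mul1r. Qed.

Lemma mxtrace_outer n (A : 'M[R]_n) w : \tr (A *m (w *m w^T)) = qf A w.
Proof. by rewrite mulmxA mxtrace_mulC mulmxA /qf /mxtrace big_ord1. Qed.

Lemma vnorm_ge0 n (v : 'cV[R]_n) : 0 <= vnorm v.
Proof. exact: sqrtr_ge0. Qed.
Lemma sqr_vnorm n (v : 'cV[R]_n) : vnorm v ^+ 2 = sqnorm v.
Proof. by rewrite sqr_sqrtr ?sqnorm_ge0. Qed.

(** The squared norm of [|v| u - |u| v] is [2 |u| |v| (|u| |v| - dotv u v)]; divide by the positive
    factor. *)
Lemma cauchy_schwarz n (u v : 'cV[R]_n) : dotv u v <= vnorm u * vnorm v.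
Proof.
have [u0|u0] := eqVneq u 0.
  by rewrite u0 /dotv linear0 mul0mx mxE mulr_ge0 ?vnorm_ge0.
have [v0|v0] := eqVneq v 0.
  by rewrite v0 /dotv mulmx0 mxE mulr_ge0 ?vnorm_ge0.
have p0 n' (x : 'cV[R]_n') : x != 0 -> 0 < vnorm x.
  by move=> x0; rewrite sqrtr_gt0 lt_neqAle sqnorm_ge0 eq_sym sqnorm_eq0 x0.
have := sqnorm_ge0 (vnorm v *: u + (- vnorm u) *: v).
rewrite sqnormD !sqnormZ dotvZl dotvZr -!sqr_vnorm => h.
have uv : 0 < vnorm u * vnorm v by rewrite mulr_gt0 ?p0.
rewrite -subr_ge0 -(pmulr_rge0 _ uv) -(pmulr_rge0 _ (ltr0n _ 2)).
by move: h; congr (0 <= _); ring.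
Qed.

Lemma vnorm_triangle n (u v : 'cV[R]_n) : vnorm (u + v) <= vnorm u + vnorm v.
Proof.
rewrite -(@ler_pXn2r _ 2) ?nnegrE ?addr_ge0 ?vnorm_ge0 // sqr_vnorm sqnormD.
rewrite sqrrD !sqr_vnorm; have := cauchy_schwarz u v; lra.
Qed.

Lemma qf_ge_of_unit n (A : 'M[R]_n) a :
  (forall w, sqnorm w = 1 -> a <= qf A w) -> forall v, a * sqnorm v <= qf A v.
Proof.
move=> h v; have [->|v0] := eqVneq v 0.
  by rewrite qf_dotv mulmx0 -dotvv /dotv mulmx0 mxE mulr0.
have [r r0 rv] := normalize v0; have := h _ rv; rewrite qfZv; rewrite sqnormZ in rv.
have r2 : 0 < r ^+ 2 by rewrite exprn_even_gt0.
by rewrite -(ler_pM2l r2) mulrCA rv mulr1.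
Qed.

(** Here [a] is a coordinate along a unit vector, [r] the norm of the orthogonal part and [p] half
    the cross coefficient up to sign. Lowering [c] and [m] to [g] leaves at least
    [g (|a| - r) ^ 2]. *)
Lemma quadratic_margin (g a p r c m : R) : 0 <= g -> 0 <= r ->
  `|p| <= g * r -> g <= c -> g <= m -> 0 <= c * a ^+ 2 - 2 * a * p + m * r ^+ 2.
Proof.
move=> g0 r0 hp gc gm.
have h1 : 0 <= (c - g) * a ^+ 2 by rewrite mulr_ge0 ?sqr_ge0 ?subr_ge0.
have h2 : 0 <= (m - g) * r ^+ 2 by rewrite mulr_ge0 ?sqr_ge0 ?subr_ge0.
have h3 : a * p <= `|a| * (g * r).
  by apply: le_trans (ler_norm _) _; rewrite normrM ler_wpM2l.
have h4 : 0 <= g * (`|a| - r) ^+ 2 by rewrite mulr_ge0 ?sqr_ge0.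
have h5 : `|a| ^+ 2 = a ^+ 2 by rewrite real_normK ?num_real.
have : c * a ^+ 2 - 2 * a * p + m * r ^+ 2 = (c - g) * a ^+ 2 +
   (m - g) * r ^+ 2 + 2 * (`|a| * (g * r) - a * p) + g * (`|a| - r) ^+ 2.
  by rewrite [(`|a| - r) ^+ 2]sqrrB h5; ring.
lra.
Qed.

(** For a unit vector [w], the orthogonal projector onto its complement. *)
Definition perp n (w : 'cV[R]_n) : 'M[R]_n := 1%:M - w *m w^T.

Lemma perpT n (w : 'cV[R]_n) : (perp w)^T = perp w.
Proof. by rewrite /perp linearB /= trmx1 trmx_mul trmxK. Qed.

Lemma perp_mul n (w v : 'cV[R]_n) : perp w *m v = v - dotv w v *: w.
Proof.
by rewrite /perp mulmxBl mul1mx -mulmxA [w^T *m v]mx11_scalar mul_mx_scalar.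
Qed.

Lemma dotv_perp n (w v : 'cV[R]_n) : sqnorm w = 1 -> dotv w (perp w *m v) = 0.
Proof.
by move=> w1; rewrite perp_mul -scaleNr dotvDr dotvZr dotvv w1 mulr1 subrr.
Qed.

Lemma sqnorm_perp n (w v : 'cV[R]_n) : sqnorm w = 1 ->
  sqnorm v = dotv w v ^+ 2 + sqnorm (perp w *m v).
Proof.
move=> w1; rewrite perp_mul -scaleNr sqnormD sqnormZ dotvZr w1 (dotvC v w); ring.
Qed.

Lemma qf_perp n (A : 'M[R]_n) (w v : 'cV[R]_n) : A^T = A ->
  qf A v = dotv w v ^+ 2 * qf A w + 2 * dotv w v * dotv (A *m w) (perp w *m v)
           + qf A (perp w *m v).
Proof.
move=> symA; rewrite {1}(_ : v = dotv w v *: w + perp w *m v).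
  by rewrite qfDv // qfZv -scalemxAr dotvZl mulrA.
by rewrite perp_mul addrC subrK.
Qed.

(** [A - a] kills [w] on the right and, by symmetry, on the left, so projecting [w] away changes
    nothing. *)
Lemma perp_conj_eigen n (A : 'M[R]_n) (w : 'cV[R]_n) a : A^T = A -> A *m w = a *: w ->
  perp w *m (A - a%:M) *m perp w = A - a%:M.
Proof.
move=> symA Aw; have Bw : (A - a%:M) *m w = 0.
  by rewrite mulmxBl Aw mul_scalar_mx subrr.
have wB : w^T *m (A - a%:M) = 0.
  by rewrite -[LHS]trmxK trmx_mul trmxK linearB /= symA tr_scalar_mx Bw trmx0.
rewrite /perp mulmxBl mul1mx -mulmxA wB mulmx0 subr0 mulmxBr mulmx1 mulmxA Bw.
by rewrite mul0mx subr0.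
Qed.

End Forms.

(** * Block structure of the lifted matrix *)

Section Blocks.
Variables (R : rcfType) (l : nat).
Implicit Types (W : 'M[R]_(4 * l.+1)).

Lemma blk_idx_inj : injective (fun p : 'I_l.+1 * 'I_4 => blk_idx p.1 p.2).
Proof.
move=> [i a] [j b] /(congr1 val) /= e.
by congr pair; apply: val_inj => /=; have := ltn_ord a; have := ltn_ord b; lia.
Qed.

Lemma sum_blk_idx (V : nmodType) (F : 'I_(4 * l.+1) -> V) :
  \sum_r F r = \sum_(i < l.+1) \sum_(a < 4) F (blk_idx i a).
Proof.
rewrite pair_bigA /= (reindex (fun p : 'I_l.+1 * 'I_4 => blk_idx p.1 p.2)) //.
apply/onW_bij/inj_card_bij; first exact: blk_idx_inj.
by rewrite card_prod !card_ord mulnC.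
Qed.

Lemma divn_blk_idx (i : 'I_l.+1) (a : 'I_4) : (blk_idx i a %/ 4 = i)%N.
Proof. by rewrite /= mulnC divnMDl // divn_small ?addn0. Qed.

Lemma modn_blk_idx (i : 'I_l.+1) (a : 'I_4) : inord (blk_idx i a %% 4) = a.
Proof. by rewrite /= mulnC modnMDl modn_small ?inord_val. Qed.

Lemma mxtrace_mul_blocks (A W : 'M[R]_(4 * l.+1)) :
  \tr (A *m W) = \sum_i \sum_j \tr (block A i j *m block W j i).
Proof.
rewrite /mxtrace sum_blk_idx; apply: eq_bigr => i _.
rewrite exchange_big; apply: eq_bigr => a _; rewrite mxE sum_blk_idx.
by apply: eq_bigr => j _; rewrite mxE; apply: eq_bigr => b _; rewrite !mxE.
Qed.

Lemma block_tr W i j : W^T = W -> block W i j = (block W j i)^T.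
Proof. by move=> symW; apply/matrixP=> a b; rewrite -{1}symW !mxE. Qed.

(** Test [W] on the Kronecker product of [c] and [v], whose [i]-th block is [c i] times [v]. *)
Lemma psd_block_comb W (c : 'I_l.+1 -> R) : psd W ->
  psd (\sum_i \sum_j (c i * c j) *: block W i j).
Proof.
move=> pW v.
pose x : 'cV[R]_(4 * l.+1) := \col_r (c (inord (r %/ 4)) * v (inord (r %% 4)) 0).
have xE i a : x (blk_idx i a) 0 = c i * v a 0.
  by rewrite mxE divn_blk_idx modn_blk_idx inord_val.
suff -> : qf (\sum_i \sum_j (c i * c j) *: block W i j) v = qf W x by apply: pW.
rewrite qf_sum [RHS]qf_dotv dotvE sum_blk_idx; apply: eq_bigr => i _.
rewrite qf_sum.
under [RHS]eq_bigr => a _ do rewrite [X in _ * X]mxE sum_blk_idx mulr_sumr.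
rewrite [RHS]exchange_big; apply: eq_bigr => j _.
rewrite qfZ qf_dotv dotvE mulr_sumr; apply: eq_bigr => a _.
rewrite mxE !mulr_sumr; apply: eq_bigr => b _; rewrite !xE mxE; ring.
Qed.

Lemma sum_delta (V : lmodType R) (F : 'I_l.+1 -> V) i :
  \sum_j (j == i)%:R *: F j = F i.
Proof.
rewrite (bigD1 i) //= eqxx scale1r big1 ?addr0 // => j /negPf ->.
by rewrite scale0r.
Qed.

Lemma psd_block W i : psd W -> psd (block W i i).
Proof.
move=> pW; have := @psd_block_comb W (fun j => (j == i)%:R) pW.
under eq_bigr => j _ do under eq_bigr => k _ do rewrite -scalerA.
by under eq_bigr => j _ do rewrite -scaler_sumr sum_delta; rewrite sum_delta.
Qed.

(** Take [c] to be the difference of the basis vectors at [i] and [j]. For feasible [W] and [i = 0]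
    the constraints reduce the result to [W_00 - W_jj]. *)
Lemma psd_block_diff W i j : psd W ->
  psd (block W i i - block W i j - (block W j i - block W j j)).
Proof.
move=> pW; have := @psd_block_comb W (fun k => (k == i)%:R - (k == j)%:R) pW.
have sumd (V : lmodType R) (F : 'I_l.+1 -> V) :
    \sum_k ((k == i)%:R - (k == j)%:R) *: F k = F i - F j.
  by under eq_bigr => k _ do rewrite scalerBl; rewrite sumrB !sum_delta.
under eq_bigr => h _ do under eq_bigr => k _ do rewrite -scalerA.
by under eq_bigr => h _ do rewrite -scaler_sumr sumd; rewrite sumd.
Qed.

End Blocks.

(** * The relaxed objective and weak duality *)

Section Relaxation.
Variables (R : rcfType) (l : nat) (Q : nat -> 'M[R]_4) (c2 : nat -> R).

Lemma block_bigQ (i j : 'I_l.+1) : block (bigQ l Q c2) i j =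
  if (i == 0 :> nat) && (0 < j)%N then (1/2) *: (Q j.-1 - (c2 j.-1)%:M)
  else if (j == 0 :> nat) && (0 < i)%N then (1/2) *: (Q i.-1 - (c2 i.-1)%:M)
  else 0.
Proof.
apply/matrixP=> a b; rewrite 2!mxE; cbv zeta.
rewrite (divn_blk_idx i a) (divn_blk_idx j b) (modn_blk_idx i a) (modn_blk_idx j b).
by case: ifP => // _; case: ifP => // _; rewrite mxE.
Qed.

(** Symmetry and the constraints give [W_0i = W_i0 = W_ii], so the two halves of each cost block
    recombine. *)
Lemma sdr_obj_blocks (W : 'M[R]_(4 * l.+1)) : sdr_feasible W ->
  sdr_obj Q c2 W =
  \sum_(i < l) \tr ((Q i - (c2 i)%:M) *m block W (lift ord0 i) (lift ord0 i))
  + \sum_(i < l) c2 i.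
Proof.
case=> symW [_ [W0 _]]; congr (_ + _); rewrite mxtrace_mul_blocks.
have W0i i : block W ord0 (lift ord0 i) = block W (lift ord0 i) (lift ord0 i).
  by apply: W0.
have Wi0 i : block W (lift ord0 i) ord0 = block W (lift ord0 i) (lift ord0 i).
  by rewrite (block_tr _ _ symW) W0i -block_tr.
rewrite big_ord_recl big_ord_recl block_bigQ /= mul0mx mxtrace0 add0r.
rewrite -big_split; apply: eq_bigr => i _ /=.
rewrite big_ord_recl big1 => [|j _]; last by rewrite block_bigQ /= mul0mx mxtrace0.
rewrite !block_bigQ /= addr0 W0i Wi0 -!scalemxAl mxtraceZ.
by field.
Qed.

Lemma sdr_weak_duality (T : 'I_l -> 'M[R]_4) m (W : 'M[R]_(4 * l.+1)) :
  (forall i : 'I_l, (Q i)^T = Q i) -> (forall i, (T i)^T = T i) ->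
  (forall i : 'I_l, psd (Q i - T i)) -> (forall i : 'I_l, psd ((c2 i)%:M - T i)) ->
  \sum_i T i = m%:M -> sdr_feasible W -> m <= sdr_obj Q c2 W.
Proof.
move=> symQ symT pQT pcT sT fW; rewrite sdr_obj_blocks //.
have [symW [pW [W0 tW]]] := fW; set V := block W ord0 ord0 in tW.
pose U (i : 'I_l) := block W (lift ord0 i) (lift ord0 i).
have VU i : psd (V - U i).
  move=> v; have := psd_block_diff ord0 (lift ord0 i) pW v.
  rewrite W0 // (block_tr (lift ord0 i) ord0 symW) W0 // -block_tr //.
  by rewrite subrr subr0.
(* As the [T i] sum to [m] and [V] has trace 1, the left side is [m] minus the sum of the [c2 i]. *)
suff : \sum_(i < l) - \tr (((c2 i)%:M - T i) *m V) <=
       \sum_(i < l) \tr ((Q i - (c2 i)%:M) *m U i).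
  rewrite -(lerD2r (\sum_(i < l) c2 i)); apply: le_trans.
  rewrite sumrN -raddf_sum /= -mulmx_suml sumrB sT mulmxBl raddfB /=.
  rewrite mul_scalar_mx mxtraceZ tW mulr1 -raddf_sum mul_scalar_mx mxtraceZ tW.
  by rewrite mulr1 opprB subrK.
apply: ler_sum => i _; rewrite -subr_ge0 opprK.
(* Regroup the difference into two traces of products of positive semidefinite matrices, using
   [0 <= U i <= V]. *)
rewrite (_ : _ + _ = \tr ((Q i - T i) *m U i) +
                     \tr (((c2 i)%:M - T i) *m (V - U i))).
  apply: addr_ge0; apply: mxtrace_mul_psd => //.
  - by rewrite linearB /= symQ symT.
  - exact: psd_block.
  - by rewrite linearB /= tr_scalar_mx symT.
by rewrite !mulmxBl !mulmxBr !raddfB /=; ring.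
Qed.

Lemma block_omega (w : 'cV[R]_4) (i j : 'I_l.+1) :
  block (omega l w *m (omega l w)^T) i j = w *m w^T.
Proof.
apply/matrixP=> a b; rewrite !mxE; apply: eq_bigr => k _.
by rewrite !mxE !modn_blk_idx (ord1 k).
Qed.

Lemma sdr_feasible_omega (w : 'cV[R]_4) : unit4 w ->
  sdr_feasible (omega l w *m (omega l w)^T).
Proof.
move=> w1; split; first by rewrite trmx_mul trmxK.
split.
  move=> v; rewrite qf_dotv -mulmxA [_^T *m v]mx11_scalar mul_mx_scalar dotvZr.
  by rewrite dotvC -expr2 sqr_ge0.
split=> [i _|]; rewrite !block_omega //.
by rewrite -(mul1mx (w *m _)) mxtrace_outer qf_scalar w1 mulr1.
Qed.

Lemma sdr_obj_omega (w : 'cV[R]_4) : unit4 w ->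
  sdr_obj Q c2 (omega l w *m (omega l w)^T) = \sum_(i < l) qf (Q i) w.
Proof.
move=> w1; rewrite sdr_obj_blocks; last exact: sdr_feasible_omega.
rewrite -big_split; apply: eq_bigr => i _ /=.
by rewrite block_omega mxtrace_outer qfB qf_scalar w1 mulr1 subrK.
Qed.

End Relaxation.

(** * The dual certificate *)

Section Certificate.
Variables (R : rcfType) (n l : nat) (w : 'cV[R]_n) (Q : 'I_l -> 'M[R]_n).
Let S := \sum_i Q i.
Hypotheses (l2 : (2 <= l)%N) (w1 : sqnorm w = 1).
Hypotheses (symQ : forall i, (Q i)^T = Q i) (psdQ : forall i, psd (Q i)).
Hypothesis Sw : S *m w = qf S w *: w.
Variable mu : R.
Hypothesis mu_gt0 : 0 < mu.
Hypothesis gap : l%:R / l.-1%:R * qf S w <= mu.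
Hypothesis S_perp : forall v, dotv w v = 0 -> mu * sqnorm v <= qf S v.

Let lam := qf S w.
Let k := lam / mu / l.-1%:R.

(* [dual_cert i] is the certificate [T i]; here [mu] stands for [lmin2 S]. *)
Definition dual_compl i : 'M[R]_n :=
  Q i - (lam / l%:R)%:M - k *: (l%:R *: Q i - S).
Definition dual_cert i : 'M[R]_n := Q i - perp w *m dual_compl i *m perp w.

Lemma trmx_sumQ : S^T = S.
Proof. by rewrite /S raddf_sum; apply: eq_bigr => i _ /=; rewrite symQ. Qed.

Lemma dual_complT i : (dual_compl i)^T = dual_compl i.
Proof.
have trZ a (A : 'M[R]_n) : (a *: A)^T = a *: A^T by rewrite linearZ.
by rewrite /dual_compl 2!raddfB /= trZ raddfB /= trZ tr_scalar_mx trmx_sumQ symQ.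
Qed.

Lemma dual_certT i : (dual_cert i)^T = dual_cert i.
Proof. by rewrite linearB /= !trmx_mul perpT dual_complT symQ mulmxA. Qed.

Lemma lam_ge0 : 0 <= lam.
Proof. by rewrite /lam qf_sum sumr_ge0 // => i _; apply: psdQ. Qed.

Lemma l_gt0 : 0 < l%:R :> R.
Proof. by rewrite ltr0n (ltn_trans _ l2). Qed.

Lemma lp_gt0 : 0 < l.-1%:R :> R.
Proof. by rewrite ltr0n -subn1 subn_gt0. Qed.

(** The corrections [k (l Q i - S)] cancel in the sum, leaving [S - lam] between the projectors;
    since [w] is an eigenvector of [S] for [lam], the projectors leave it unchanged. *)
Lemma sum_dual_cert : \sum_i dual_cert i = lam%:M.
Proof.
have l0 := lt0r_neq0 l_gt0.
rewrite sumrB -mulmx_suml -mulmx_sumr.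
have -> : \sum_i dual_compl i = S - lam%:M.
  rewrite /dual_compl 2!sumrB -/S -scaler_sumr sumrB -scaler_sumr -/S.
  rewrite sumr_const [X in _ - _ - k *: (_ - X)]sumr_const card_ord.
  by rewrite scaler_nat subrr scaler0 subr0 -scaler_nat scale_scalar_mx mulrC divfK.
by rewrite perp_conj_eigen ?trmx_sumQ // opprB addrC subrK.
Qed.

(** On [u] orthogonal to [w] the form is [(1 - k l) qf (Q i) u + k qf S u - (lam / l) |u| ^ 2]. The
    gap says exactly [k l <= 1], and [k qf S u] is at least
    [k mu |u| ^ 2 = lam / (l - 1) |u| ^ 2]. *)
Lemma psd_dual_slack i : psd (Q i - dual_cert i).
Proof.
move=> v; rewrite /dual_cert opprB addrC subrK qf_conj ?perpT //.
set u := perp w *m v; have wu : dotv w u = 0 by apply: dotv_perp.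
rewrite /dual_compl !(qfB, qfZ) qf_scalar.
have l0 := lt0r_neq0 l_gt0; have lp0 := lt0r_neq0 lp_gt0; have mu0 := lt0r_neq0 mu_gt0.
have k0 : 0 <= k by rewrite !divr_ge0 ?lam_ge0 ?ltW ?lp_gt0.
have kl : k * l%:R <= 1.
  rewrite /k mulrAC ler_pdivrMr ?lp_gt0 // mul1r mulrAC ler_pdivrMr //.
  move: gap; rewrite -/lam mulrAC ler_pdivrMr ?lp_gt0 //.
  by rewrite mulrC [mu * _]mulrC.
have hS := S_perp wu; have s0 := sqnorm_ge0 u; have q0 := psdQ i u.
have h1 : 0 <= (1 - k * l%:R) * qf (Q i) u by rewrite mulr_ge0 // subr_ge0.
have h2 : k * (mu * sqnorm u) <= k * qf S u by rewrite ler_wpM2l.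
have h3 : lam / l%:R * sqnorm u <= k * mu * sqnorm u.
  rewrite ler_wpM2r // /k mulrAC divfK // ler_wpM2l ?lam_ge0 //.
  by rewrite lef_pV2 ?posrE ?l_gt0 ?lp_gt0 // ler_nat leq_pred.
lra.
Qed.

(** Write [v = a w + u] with [u] orthogonal to [w]. The terms [qf (Q i) u] cancel, and the cross
    term is at most [2 |a| |Q i w| |u|] in size, so a margin of [|Q i w|] on both diagonal
    coefficients suffices. *)
Lemma psd_dual_bound i c t :
  (forall v, qf (l%:R *: Q i - S) v <= t * sqnorm v) ->
  qf (Q i) w + vnorm (Q i *m w) <= c ->
  lam / l%:R + k * t + vnorm (Q i *m w) <= c -> psd (c%:M - dual_cert i).
Proof.
move=> ht h1 h2 v; rewrite /dual_cert !qfB qf_scalar qf_conj ?perpT //.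
rewrite (qf_perp w v (symQ i)) (sqnorm_perp v w1); set u := perp w *m v.
rewrite /dual_compl !(qfB, qfZ) qf_scalar; set p := dotv (Q i *m w) u.
set a := dotv w v; have g0 := vnorm_ge0 (Q i *m w); set g := vnorm _ in g0 h1 h2.
have k0 : 0 <= k by rewrite !divr_ge0 ?lam_ge0 ?ltW ?lp_gt0.
have := ler_wpM2l k0 (ht u); rewrite qfB qfZ.
have hp : `|p| <= g * vnorm u.
  rewrite ler_norml cauchy_schwarz andbT lerNl -mulN1r -dotvZr scaleN1r.
  apply: le_trans (cauchy_schwarz _ _) _.
  by rewrite /vnorm sqnormN.
have gc : g <= c - qf (Q i) w by lra.
have gm : g <= c - (lam / l%:R + k * t) by lra.
have := quadratic_margin a g0 (vnorm_ge0 u) hp gc gm; rewrite sqr_vnorm.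
lra.
Qed.

End Certificate.

(** * Rotations, tightness and the angle bound *)

Section Main.
Variable R : rcfType.

Lemma sum_ord3 (V : nmodType) (F : 'I_3 -> V) : \sum_i F i = F 0 + F 1 + F 2.
Proof.
rewrite !big_ord_recl big_ord0 addr0 addrA.
by congr (_ + F _ + F _); apply: val_inj.
Qed.

Lemma sum_ord4 (V : nmodType) (F : 'I_4 -> V) : \sum_i F i = F 0 + F 1 + F 2 + F 3.
Proof.
rewrite !big_ord_recl big_ord0 addr0 !addrA.
by congr (_ + F _ + F _ + F _); apply: val_inj.
Qed.

Lemma sqnorm_Rq (w : 'cV[R]_4) (x : 'cV[R]_3) :
  sqnorm (Rq w *m x) = sqnorm w ^+ 2 * sqnorm x.
Proof.
rewrite /sqnorm sum_ord4 !sum_ord3 !mxE !sum_ord3 !mxE /=; ring.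
Qed.

Theorem sdr_tight_of_rayleigh_min (l : nat) (hl : (2 <= l)%N)
  (Q : nat -> 'M[R]_4)
  (symQ : forall i, (i < l)%N -> (Q i)^T = Q i)
  (psdQ : forall i, (i < l)%N -> psd (Q i))
  (c2 : nat -> R)
  (wh : 'cV[R]_4) (hwh : unit4 wh)
  (hmin : forall v, qf (\sum_(i < l) Q i) wh * sqnorm v <= qf (\sum_(i < l) Q i) v)
  (hzeta0 : 0 < lmin2 (\sum_(i < l) Q i))
  (hzeta : l%:R / (l.-1)%:R * lmin (\sum_(i < l) Q i) <= lmin2 (\sum_(i < l) Q i))
  (hc : forall i, (i < l)%N ->
     qf (Q i) wh + vnorm (Q i *m wh) + (`|dval l Q wh i| + dval l Q wh i) / 2 < c2 i) :
  sdr_tight l Q c2 wh.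
Proof.
set S := \sum_(i < l) Q i in hmin hzeta0 hzeta.
pose Q' (i : 'I_l) := Q i.
have symQ' i : (Q' i)^T = Q' i by apply: symQ.
have psdQ' i : psd (Q' i) by apply: psdQ.
have sS : S^T = S := trmx_sumQ symQ'.
have [Sw lminS Sperp] := rayleigh_min sS hwh erefl hmin.
rewrite lminS in hzeta.
split; first exact: sdr_feasible_omega.
move=> W fW; rewrite sdr_obj_omega // -qf_sum.
apply: (@sdr_weak_duality _ _ _ _ (dual_cert wh Q' (lmin2 S))) fW => //.
- exact: dual_certT.
- by move=> i; apply: psd_dual_slack.
- move=> i; have hi := hc i (ltn_ord i).
  (* [(|d| + d) / 2] is the positive part of [d]. Being nonnegative, it yields the bound along [wh];
     being at least [d], it yields the bound on the complement. *)
  have d0 : 0 <= (`|dval l Q wh i| + dval l Q wh i) / 2.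
    by have := ler_norm (- dval l Q wh i); rewrite normrN; lra.
  have d1 : dval l Q wh i <= (`|dval l Q wh i| + dval l Q wh i) / 2.
    by have := ler_norm (dval l Q wh i); lra.
  have ht v : qf (l%:R *: Q' i - S) v <= lmax (l%:R *: Q' i - S) * sqnorm v.
    by apply: qf_le_lmax; rewrite raddfB /= sS linearZ /= symQ'.
  apply: (psd_dual_bound hl hwh symQ' psdQ' hzeta0 ht).
    by rewrite /Q'; lra.
  (* The missing term [j = i] is zero, so the sum can run over all [j]. *)
  have dE : \sum_(j < l | (j : nat) != i) (Q i - Q j) = l%:R *: Q i - S.
    transitivity (\sum_(j < l) (Q i - Q j)).
      rewrite [RHS](bigD1 i) //= subrr add0r; apply: eq_bigl => j.
      by rewrite -val_eqE.
    by rewrite sumrB sumr_const card_ord scaler_nat.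
  move: d1; rewrite {1}/dval -/S dE lminS -qf_sum -/S.
  by rewrite /Q' -/S; lra.
- by rewrite (sum_dual_cert hl).
Qed.


(* Cauchy-Schwarz on the cross term; the factor 4 is [2 * 2], as rotations are
   isometries and so [|Rq w0 x - Rq w x| <= 2 |x|]. *)
Lemma sqnorm_residual (w0 w : 'cV[R]_4) (x e : 'cV[R]_3) : unit4 w0 -> unit4 w ->
  sqnorm (Rq w0 *m x - Rq w *m x) <=
  sqnorm (Rq w0 *m x + e - Rq w *m x) - sqnorm e + 4 * (vnorm e * vnorm x).
Proof.
move=> u0 u1; rewrite (addrAC _ e); set r := Rq w0 *m x - Rq w *m x.
have vR v : unit4 v -> vnorm (Rq v *m x) = vnorm x.
  by move=> uv; rewrite /vnorm sqnorm_Rq uv expr1n mul1r.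
have r2 : vnorm r <= 2 * vnorm x.
  apply: le_trans (vnorm_triangle _ _) _.
  by rewrite /vnorm sqnormN -/(vnorm _) vR // -/(vnorm _) vR // mulr_natl mulr2n.
have := cauchy_schwarz (- r) e; rewrite -scaleN1r dotvZl.
rewrite scaleN1r {1}/vnorm sqnormN -/(vnorm r) => h.
have h2 := ler_wpM2r (vnorm_ge0 e) r2.
by rewrite (sqnormD r e); lra.
Qed.

End Main.

(** The ratio condition is in product form, which includes [lmin = 0], where the ratio is infinite.
    The angle bound assumes a positive denominator because division by zero returns 0. *)
Theorem theorem3p7 (R : rcfType) (l : nat) (hl : (2 <= l)%N)
  (w0s : 'cV[R]_4) (hw0s : unit4 w0s)
  (x y eps : nat -> 'cV[R]_3)
  (hy : forall i, (i < l)%N -> y i = Rq w0s *m x i + eps i)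
  (Q P : nat -> 'M[R]_4)
  (hQ : forall i, (i < l)%N -> (Q i)^T = Q i /\
          forall w, unit4 w -> qf (Q i) w = sqnorm (y i - Rq w *m x i))
  (hP : forall i, (i < l)%N -> (P i)^T = P i /\
          forall w, unit4 w -> qf (P i) w = sqnorm (Rq w0s *m x i - Rq w *m x i))
  (c2 : nat -> R) (hc2 : forall i, (i < l)%N -> 0 <= c2 i)
  (wh : 'cV[R]_4) (hwh : unit4 wh)
  (hmin : forall w, unit4 w -> tls l Q c2 wh <= tls l Q c2 w)
  (hzeta0 : 0 < lmin2 (\sum_(i < l) Q i))
  (hzeta : l%:R / (l.-1)%:R * lmin (\sum_(i < l) Q i) <= lmin2 (\sum_(i < l) Q i))
  (hc : forall i, (i < l)%N ->
     qf (Q i) wh + vnorm (Q i *m wh) + (`|dval l Q wh i| + dval l Q wh i) / 2 < c2 i) :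
  sdr_tight l Q c2 wh /\
  (0 < lmin2 (\sum_(i < l) P i) ->
     1 - (wh^T *m w0s) ord0 ord0 ^+ 2
       <= 4 * (\sum_(i < l) vnorm (eps i) * vnorm (x i)) / lmin2 (\sum_(i < l) P i)).
Proof.
have psd_res (A : nat -> 'M[R]_4) (r : nat -> 'cV[R]_4 -> 'cV[R]_3) :
    (forall i, (i < l)%N -> (A i)^T = A i /\
       forall w, unit4 w -> qf (A i) w = sqnorm (r i w)) ->
    forall i, (i < l)%N -> psd (A i).
  move=> hA i /hA [_ Ai] v; have := @qf_ge_of_unit _ _ (A i) 0 _ v; rewrite mul0r; apply.
  by move=> w /Ai ->; apply: sqnorm_ge0.
have psdQ := psd_res Q (fun i w => y i - Rq w *m x i) hQ.
have psdP := psd_res P (fun i w => Rq w0s *m x i - Rq w *m x i) hP.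
(* Each [c2 i] exceeds [qf (Q i) wh] by nonnegative terms, so no truncation occurs at [wh]. *)
have tlswh : tls l Q c2 wh = \sum_(i < l) qf (Q i) wh.
  apply: eq_bigr => i _; apply: min_idPl; have := hc i (ltn_ord i).
  have := vnorm_ge0 (Q i *m wh); have := ler_norm (- dval l Q wh i).
  rewrite normrN; lra.
have minS w : unit4 w -> \sum_(i < l) qf (Q i) wh <= \sum_(i < l) qf (Q i) w.
  move=> uw; rewrite -tlswh; apply: le_trans (hmin _ uw) _.
  by apply: ler_sum => i _; rewrite ge_min lexx.
split.
  apply: sdr_tight_of_rayleigh_min => // [i /hQ[] //|].
  by apply: qf_ge_of_unit => w; rewrite !qf_sum; apply: minS.
set SP := \sum_(i < l) P i => lam_gt0.
have symSP : SP^T = SP.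
  by rewrite /SP raddf_sum; apply: eq_bigr => i _ /=; have [] := hP i (ltn_ord i).
have SP0 : qf SP w0s = 0.
  rewrite qf_sum big1 // => i _; have [_ ->//] := hP i (ltn_ord i).
  by rewrite subrr; apply/eqP; rewrite sqnorm_eq0.
have minP v : 0 * sqnorm v <= qf SP v.
  by rewrite mul0r qf_sum sumr_ge0 // => i _; apply: psdP.
have [SPw _ perpP] := rayleigh_min symSP hw0s SP0 minP.
have dotE : (wh^T *m w0s) 0 0 = dotv w0s wh by rewrite dotvC.
rewrite ler_pdivlMr // dotE.
(* Pythagoras: the squared sine is the squared length of the part of [wh] orthogonal to [w0s]. *)
have -> : 1 - dotv w0s wh ^+ 2 = sqnorm (perp w0s *m wh).
  have := sqnorm_perp wh hw0s; rewrite hwh; lra.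
rewrite mulrC; apply: le_trans (perpP _ (dotv_perp _ hw0s)) _.
have -> : qf SP (perp w0s *m wh) = qf SP wh.
  rewrite (qf_perp w0s wh symSP) SP0 SPw scale0r /dotv trmx0 mul0mx [(0 : 'M_1) 0 0]mxE.
  by rewrite !mulr0 !add0r.
(* Compare [wh] with [w0s], whose residuals are exactly the [eps i]. *)
have res : \sum_(i < l) (sqnorm (y i - Rq wh *m x i) - sqnorm (eps i)) <= 0.
  rewrite sumrB subr_le0; have := minS _ hw0s.
  congr (_ <= _); apply: eq_bigr => i _; have [_ ->//] := hQ i (ltn_ord i).
  by rewrite hy // addrAC subrr add0r.
rewrite qf_sum mulr_sumr -[X in _ <= X]add0r; apply: le_trans (lerD res (lexx _)).
rewrite -big_split; apply: ler_sum => i _ /=.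
have [_ ->//] := hP i (ltn_ord i).
by rewrite hy //; apply: sqnorm_residual.
Qed.
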